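(* Let $\mathcal{P}_v$ be the set of vectors ($\Re$-equivalence classes of arrows) of an arrow space $\mathcal{P}_A$ satisfying Axioms 1, 2, 4, 5 stated in the context. For any $[\overrightarrow{AB}],[\overrightarrow{CD}]\in\mathcal{P}_v$ and any $t\in\mathbb{R}$: (1) $t\,([\overrightarrow{AB}]+_V[\overrightarrow{CD}])=t\,[\overrightarrow{AB}]+_V t\,[\overrightarrow{CD}]$; (2) $1\,[\overrightarrow{AB}]=[\overrightarrow{AB}]$.
   Context: Let $\mathcal{P}$ be an infinite set whose elements are called points. An arrow is an ordered pair of points $\overrightarrow{AB}=(A,B)$ (tail $A$, head $B$; $A=B$ is allowed). The arrow space $\mathcal{P}_A$ is the set of all arrows; two arrows are equal iff they have the same tail and the same head. Negation: $-\overrightarrow{AB}=\overrightarrow{BA}$. Arrow addition is the partial operation $\overrightarrow{AB}+_A\overrightarrow{BC}=\overrightarrow{AC}$, defined exactly when the head of the first arrow equals the tail of the second. Axiom 1: there is a given map (arrow pre-inner product) $\langle -,-\rangle_A:\mathcal{P}_A\times\mathcal{P}_A\to\mathbb{R}$ such that for all points: $\langle\overrightarrow{AB},\overrightarrow{AB}\rangle_A\ge 0$, with equality iff $A=B$; $\langle\overrightarrow{AB},\overrightarrow{CD}\rangle_A=\langle\overrightarrow{CD},\overrightarrow{AB}\rangle_A$; $\langle\overrightarrow{AB}+_A\overrightarrow{BC},\overrightarrow{LM}\rangle_A=\langle\overrightarrow{AB},\overrightarrow{LM}\rangle_A+\langle\overrightarrow{BC},\overrightarrow{LM}\rangle_A$;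 $\langle-\overrightarrow{AB},\overrightarrow{CD}\rangle_A=-\langle\overrightarrow{AB},\overrightarrow{CD}\rangle_A$. Measure: $\|\overrightarrow{AB}\|_A=\sqrt{\langle\overrightarrow{AB},\overrightarrow{AB}\rangle_A}$. Scalar multiplication of arrows: for $t\in\mathbb{R}$, if $A=B$ or $t=0$ then $(t)\overrightarrow{AB}=\overrightarrow{AA}$. If $A\ne B$ and $t\neq0$ then $(t)\overrightarrow{AB}=\overrightarrow{AD}$, where $D\in\mathcal{P}$ is a point (assumed to exist) with $\|\overrightarrow{AD}\|_A=|t|\,\|\overrightarrow{AB}\|_A$ and $\langle\overrightarrow{AB},\overrightarrow{AD}\rangle_A=\|\overrightarrow{AB}\|_A\|\overrightarrow{AD}\|_A$ if $t>0$, $=-\|\overrightarrow{AB}\|_A\|\overrightarrow{AD}\|_A$ if $t<0$. Axiom 2: $\langle(t)\overrightarrow{AB},\overrightarrow{CD}\rangle_A=t\langle\overrightarrow{AB},\overrightarrow{CD}\rangle_A$ for all arrows and all $t\in\mathbb{R}$. Relation $\Re$ on $\mathcal{P}_A$: $\overrightarrow{AB}\;\Re\;\overrightarrow{CD}$ iff either $A=B$ and $C=D$, or ($A\ne B$, $C\neq D$ and) $\|\overrightarrow{AB}\|_A=\|\overrightarrow{CD}\|_A$ and $\frac{\langle\overrightarrow{AB},\overrightarrow{CD}\rangle_A}{\|\overrightarrow{AB}\|_A\|\overrightarrow{CD}\|_A}=1$. Axiom 4: if $\overrightarrow{AB}\;\Re\;\overrightarrow{CD}$ and $\overrightarrow{EF}\;\Re\;\overrightarrow{GH}$,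 then $\langle\overrightarrow{AB},\overrightarrow{EF}\rangle_A=\langle\overrightarrow{CD},\overrightarrow{GH}\rangle_A$. (Then $\Re$ is an equivalence relation.) Axiom 5: for $A\neq B$ and any point $P$, there is a unique point $K$ with $\overrightarrow{AB}\;\Re\;\overrightarrow{PK}$ and a unique point $K'$ with $\overrightarrow{AB}\;\Re\;\overrightarrow{K'P}$. (For $A=B$ the same holds with $K=K'=P$.) Vectors: $\mathcal{P}_v$ is the set of $\Re$-equivalence classes $[\overrightarrow{AB}]$. Vector addition: given $[\overrightarrow{AB}],[\overrightarrow{CD}]$, choose any point $P$, let $K,L$ be the unique points with $\overrightarrow{KP}\;\Re\;\overrightarrow{AB}$ and $\overrightarrow{PL}\;\Re\;\overrightarrow{CD}$, and set $[\overrightarrow{AB}]+_V[\overrightarrow{CD}]=[\overrightarrow{KP}+_A\overrightarrow{PL}]=[\overrightarrow{KL}]$; this is well defined (independent of $P$ and of the representatives). Vector scalar multiplication: $t\,[\overrightarrow{AB}]=[(t)\overrightarrow{AB}]$, also independent of the representative. *)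

(* Defs.v *)
From HB Require Import structures.
From mathcomp Require Import all_boot all_order all_algebra generic_quotient.
From mathcomp Require Import boolp classical_sets cardinality reals.

Set Implicit Arguments.
Unset Strict Implicit.
Unset Printing Implicit Defensive.

Import Order.TTheory GRing.Theory Num.Theory.

Local Open Scope ring_scope.
Local Open Scope quotient_scope.
Local Open Scope classical_set_scope.

(* An arrow is a pair (tail, head). Points form a choiceType, which under the
   classical axioms is no restriction on the underlying set. *)
Notation arrow P := (P * P)%type.

Definition opp_arrow (P : choiceType) (x : arrow P) : arrow P := (x.2, x.1).

Definition add_arrow (P : choiceType) (x y : arrow P) : option (arrow P) :=
  if x.2 == y.1 then Some (x.1, y.2) else None.

Section PreInner.
Variables (R : realType) (P : choiceType) (ip : arrow P -> arrow P -> R).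

Definition arrow_norm (x : arrow P) : R := Num.sqrt (ip x x).

Definition scale_head (t : R) (x : arrow P) : set P :=
  [set D | [/\ arrow_norm (x.1, D) = `|t| * arrow_norm x,
     0 < t -> ip x (x.1, D) = arrow_norm x * arrow_norm (x.1, D) &
     t < 0 -> ip x (x.1, D) = - (arrow_norm x * arrow_norm (x.1, D))]].

(* xget picks an element of scale_head t x; it is the only one in an arrow
   space (scale_arrow_uniq). *)
Definition scale_arrow (t : R) (x : arrow P) : arrow P :=
  if (x.1 == x.2) || (t == 0) then (x.1, x.1)
  else (x.1, xget x.1 (scale_head t x)).

Definition arrow_rel : rel (arrow P) := fun x y =>
  (x.1 == x.2) && (y.1 == y.2) ||
  [&& x.1 != x.2, y.1 != y.2, arrow_norm x == arrow_norm y &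
      ip x y / (arrow_norm x * arrow_norm y) == 1].

End PreInner.

Record arrowSpace (R : realType) := ArrowSpace {
  point :> choiceType;
  inner : arrow point -> arrow point -> R;
  point_infinite : infinite_set [set: point];
  inner_ge0 : forall x, 0 <= inner x x;
  inner_eq0 : forall x, inner x x = 0 <-> x.1 = x.2;
  innerC : forall x y, inner x y = inner y x;
  innerD : forall x y z w, add_arrow x y = Some z ->
    inner z w = inner x w + inner y w;
  innerN : forall x y, inner (opp_arrow x) y = - inner x y;
  scale_head_ex : forall t x, x.1 <> x.2 -> t <> 0 ->
    exists D, scale_head inner t x D;
  innerZ : forall t x y, inner (scale_arrow inner t x) y = t * inner x y;
  inner_rel : forall x y z w, arrow_rel inner x y -> arrow_rel inner z w ->
    inner x z = inner y w;
  rel_from : forall x (p : point), x.1 <> x.2 ->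
    exists! k, arrow_rel inner x (p, k);
  rel_to : forall x (p : point), x.1 <> x.2 ->
    exists! k, arrow_rel inner x (k, p)
}.

Section ArrowTheory.
Variables (R : realType) (S : arrowSpace R).
Implicit Types (x y z : arrow S) (t : R).

Local Notation "<< x , y >>" := (inner (a := S) x y).
Local Notation norm := (arrow_norm (@inner R S)).
Local Notation "x ~~> y" := (arrow_rel (@inner R S) x y) (at level 70).

Lemma sqr_norm x : norm x * norm x = << x, x >>.
Proof. by rewrite -expr2 sqr_sqrtr ?inner_ge0. Qed.

Lemma norm_eq0 x : (norm x == 0) = (x.1 == x.2).
Proof.
have e : (norm x == 0) = (<< x, x >> == 0).
  by rewrite -sqr_norm mulf_eq0 orbb.
by rewrite e; apply/eqP/eqP => /inner_eq0.
Qed.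

Lemma inner_chain (A B C : S) y :
  << (A, C), y >> = << (A, B), y >> + << (B, C), y >>.
Proof. by apply: innerD; rewrite /add_arrow /= eqxx. Qed.

Lemma arrow_relP x y :
  reflect (<< x, x >> = << y, y >> /\ << x, y >> = << x, x >>) (x ~~> y).
Proof.
have ip0 u v : u.1 == u.2 -> << u, v >> = 0.
  move=> e; case: u e => a b /= /eqP <-.
  by have := inner_chain a a a v; rewrite -{1}[<< _, _ >>]addr0 => /addrI.
apply: (iffP idP).
  rewrite /arrow_rel => /orP[/andP[ex ey]|/and4P[ex ey /eqP en]].
    by rewrite !ip0.
  rewrite -!sqr_norm -en => /eqP e; split=> //.
  have n0 : norm x * norm x != 0 by rewrite mulf_eq0 orbb norm_eq0.
  by move/(canRL (mulfVK n0)): e; rewrite mul1r.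
case=> exy e; have en : norm x = norm y by rewrite /arrow_norm exy.
rewrite /arrow_rel -!norm_eq0 -en e -sqr_norm.
case: eqVneq => //= n0; rewrite eqxx /= divff //.
by rewrite mulf_neq0.
Qed.

Lemma arrow_rel_equiv : equiv_class_of (arrow_rel (@inner R S)).
Proof.
have sym x y : x ~~> y -> y ~~> x.
  by move=> /arrow_relP[e1 e2]; apply/arrow_relP; rewrite innerC e2.
have refl x : x ~~> x by apply/arrow_relP.
split=> // [x y|y x z xy yz]; first by apply/idP/idP; apply: sym.
have [e1 e2] := arrow_relP _ _ xy; have [e3 e4] := arrow_relP _ _ yz.
by apply/arrow_relP; rewrite e1 e3 (inner_rel xy (refl z)) e4 e3.
Qed.

End ArrowTheory.

Canonical arrow_equiv (R : realType) (S : arrowSpace R) :=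
  EquivRelPack (arrow_rel_equiv S).

Definition vector (R : realType) (S : arrowSpace R) :=
  {eq_quot arrow_equiv S}.

Definition vec (R : realType) (S : arrowSpace R) (A B : S) : vector S :=
  \pi_(vector S) (A, B).

(* Suitable K and L exist for every p (vec_add_ex), and the sum does not depend
   on K, p, L (vec_addE), so the default u of xget is never used. *)
Definition vec_add (R : realType) (S : arrowSpace R) (u v : vector S) :
    vector S :=
  xget u [set w | exists K p L : S,
    [/\ vec K p = u, vec p L = v & w = vec K L]].

(* The result does not depend on the representative (vec_scaleE). *)
Definition vec_scale (R : realType) (S : arrowSpace R) (t : R)
    (u : vector S) : vector S :=
  \pi_(vector S) (scale_arrow (@inner R S) t (repr u)).

Section VectorTheory.
Variables (R : realType) (S : arrowSpace R).
Local Notation "<< x , y >>" := (inner (a := S) x y).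
Local Notation norm := (arrow_norm (@inner R S)).

Lemma scale_arrow_uniq (t : R) (A B D : S) : A <> B -> t <> 0 ->
  scale_head (@inner R S) t (A, B) D ->
  scale_arrow (@inner R S) t (A, B) = (A, D).
Proof.
move=> AB t0 hD.
have hz y := innerZ (a := S) t (A, B) y.
move: hz; rewrite /scale_arrow /= (introF eqP AB) (introF eqP t0) /=.
case: xgetP => [E _ hE|/(_ _)]; last first.
  by have [E hE] := scale_head_ex (x := (A, B)) AB t0 => /(_ E).
move=> hz; congr (_, _); apply/(inner_eq0 (E, D)).
have key (F : S) : scale_head (@inner R S) t (A, B) F ->
    << (A, E), (A, F) >> = norm (A, F) * norm (A, F).
  move=> [hn hp hm]; rewrite hz hn.
  have [tp|tm|/esym//] := ltrgtP 0 t.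
    by rewrite hp // hn /= gtr0_norm //; rewrite !mulrA.
  by rewrite hm // hn /= ltr0_norm // !mulrN !mulNr !mulrN !mulrA opprK.
have eED : norm (A, E) = norm (A, D) by case: hE => ->; case: hD => ->.
have ED y : << (E, D), y >> = << (A, D), y >> - << (A, E), y >>.
  by rewrite (inner_chain A E D) addrC addKr.
rewrite (ED (E, D)) 2![<< _, (E, D) >>]innerC !ED.
rewrite [<< (A, D), (A, E) >>]innerC !key //.
by rewrite -(sqr_norm (A, D)) eED !subrr.
Qed.

Lemma vecP (A B C D : S) :
  vec A B = vec C D <-> arrow_rel (@inner R S) (A, B) (C, D).
Proof. by split=> [/eqquotP|e]//; apply/eqquotP. Qed.

Lemma vec_addE (A B C D p K L : S) :
  arrow_rel (@inner R S) (K, p) (A, B) ->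
  arrow_rel (@inner R S) (p, L) (C, D) ->
  vec_add (vec A B) (vec C D) = vec K L.
Proof.
move=> /vecP <- /vecP <-; rewrite /vec_add.
case: xgetP => [w _ [K' [q [L' [/vecP h1 /vecP h2 ->]]]]|/(_ (vec K L)) []];
  last by exists K, p, L.
have hr x : arrow_rel (@inner R S) x x by apply: (equiv_refl (arrow_equiv S)).
apply/vecP/arrow_relP.
have ex y : << (K', L'), y >> = << (K, L), y >>.
  rewrite (inner_chain K' q L') (inner_chain K p L).
  by rewrite (inner_rel h1 (hr y)) (inner_rel h2 (hr y)).
by rewrite !ex [<< (K, L), (K', L') >>]innerC ex.
Qed.

Lemma vec_add_ex (u v : vector S) (p : S) :
  exists K L, vec K p = u /\ vec p L = v.
Proof.
case: (pselect ((repr u).1 = (repr u).2)) => [eu|/(rel_to p)[K [hK _]]].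
  exists p; case: (pselect ((repr v).1 = (repr v).2)) =>
      [ev|/(rel_from p)[L [hL _]]].
    exists p; rewrite -[u]reprK -[v]reprK.
    by split; apply/eqquotP; rewrite /= /arrow_rel ?eu ?ev /= !eqxx.
  exists L; rewrite -[u]reprK -[v]reprK; split; apply/eqquotP.
    by rewrite /= /arrow_rel eu /= !eqxx.
  by rewrite equiv_sym.
exists K; case: (pselect ((repr v).1 = (repr v).2)) =>
    [ev|/(rel_from p)[L [hL _]]].
  exists p; rewrite -[u]reprK -[v]reprK; split; apply/eqquotP.
    by rewrite equiv_sym.
  by rewrite /= /arrow_rel ev /= !eqxx.
exists L; rewrite -[u]reprK -[v]reprK.
by split; apply/eqquotP; rewrite equiv_sym.
Qed.

Lemma vec_scaleE (t : R) (A B : S) :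
  vec_scale t (vec A B)
  = \pi_(vector S) (scale_arrow (@inner R S) t (A, B)).
Proof.
rewrite /vec_scale; set x := repr _.
have hx : arrow_rel (@inner R S) x (A, B).
  by apply/eqquotP; exact: (reprK (vec A B)).
have hr y : arrow_rel (@inner R S) y y by apply: (equiv_refl (arrow_equiv S)).
apply/eqquotP/arrow_relP.
have ex y : << scale_arrow (@inner R S) t x, y >>
          = << scale_arrow (@inner R S) t (A, B), y >>.
  by rewrite !innerZ (inner_rel hx (hr y)).
by rewrite !ex [<< _, scale_arrow _ t x >>]innerC ex.
Qed.

End VectorTheory.

(* Main.v *)
(* A vector is determined by the linear functional that any of its
   representatives defines on arrows, and vec_add and vec_scale act linearly on
   this functional; both identities thus reduce to identities in R. *)
Require Import Defs.
From mathcomp Require Import all_boot all_order all_algebra reals.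
From mathcomp Require Import generic_quotient.

Local Open Scope ring_scope.
Local Open Scope quotient_scope.

(** Left to right is [inner_rel] paired with reflexivity. Conversely, [arrow_relP] only compares
    inner products of [x] and [y] among themselves, so testing at [z := x] and [z := y] plus
    symmetry suffices. *)
Lemma eq_vectorP (R : realType) (S : arrowSpace R) (x y : S * S) :
  \pi_(vector S) x = \pi_(vector S) y <->
  forall z, inner (a := S) x z = inner (a := S) y z.
Proof.
have rel_refl z : arrow_rel (inner (a := S)) z z.
  exact: (equiv_refl (arrow_equiv S)).
split=> [/eqquotP xy z|exy]; first exact: inner_rel xy (rel_refl z).
by apply/eqquotP/arrow_relP; rewrite !exy innerC exy.
Qed.

(** Makes the choice of representative by [repr] invisible to [inner]. *)
Lemma inner_repr_pi (R : realType) (S : arrowSpace R) (x z : S * S) :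
  inner (a := S) (repr (\pi_(vector S) x)) z = inner (a := S) x z.
Proof. by apply eq_vectorP; rewrite reprK. Qed.

Lemma vector_ext (R : realType) (S : arrowSpace R) (u v : vector S) :
  (forall z, inner (a := S) (repr u) z = inner (a := S) (repr v) z) -> u = v.
Proof. by move=> /eq_vectorP; rewrite !reprK. Qed.

Lemma inner_vec_scale (R : realType) (S : arrowSpace R) (t : R)
    (u : vector S) (z : S * S) :
  inner (a := S) (repr (vec_scale t u)) z = t * inner (a := S) (repr u) z.
Proof. by rewrite inner_repr_pi innerZ. Qed.

(** Representatives sharing a middle point compose to an arrow representing the sum, and [inner] is
    additive along such a chain. *)
Lemma inner_vec_add (R : realType) (S : arrowSpace R) (u v : vector S)
    (z : S * S) :
  inner (a := S) (repr (vec_add u v)) z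
  = inner (a := S) (repr u) z + inner (a := S) (repr v) z.
Proof.
(* Any middle point would do; [z.1] is one at hand. *)
have [K [L [<- <-]]] := vec_add_ex u v z.1.
have rel_refl x : arrow_rel (inner (a := S)) x x.
  exact: (equiv_refl (arrow_equiv S)).
rewrite (vec_addE (rel_refl (K, z.1)) (rel_refl (z.1, L))).
by rewrite !inner_repr_pi (inner_chain K z.1 L).
Qed.

Theorem theorem57 (R : realType) (S : arrowSpace R) (A B C D : S) (t : R) :
  vec_scale t (vec_add (vec A B) (vec C D))
    = vec_add (vec_scale t (vec A B)) (vec_scale t (vec C D))
  /\ vec_scale 1 (vec A B) = vec A B.
Proof.
split; apply: vector_ext => z; last by rewrite inner_vec_scale GRing.mul1r.
by rewrite inner_vec_scale !inner_vec_add !inner_vec_scale GRing.mulrDr.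
Qed.
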